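(* Every Arnautov group is totally Taĭmanov.
   Context: Group topologies are not assumed Hausdorff. A continuous group isomorphism $f:(G,\tau)\to(H,\sigma)$ of topological groups is semitopological if there exist a topological group $(\widetilde G,\widetilde\tau)$ containing $G$ as a normal subgroup with $\widetilde\tau$ inducing $\tau$ on $G$, and an open continuous homomorphism $\widetilde f:(\widetilde G,\widetilde\tau)\to(H,\sigma)$ extending $f$. A group $G$ is an Arnautov group if for every pair of group topologies $\sigma\le\tau$ on $G$ such that $id_G:(G,\tau)\to(G,\sigma)$ is semitopological, one has $\sigma=\tau$. The Taĭmanov topology $T_G$ on a group $G$ is the group topology whose neighborhoods of $e_G$ have as a base the centralizers $c_G(F)$ of finite subsets $F\subseteq G$. A group $G$ is Taĭmanov if $T_G$ is the discrete topology (equivalently, some finite $F\subseteq G$ has $c_G(F)=\{e_G\}$), and totally Taĭmanov if $G/N$ is Taĭmanov for every normal subgroup $N$ of $G$. *)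

(* Defs.v *)
From HB Require Import structures.
From mathcomp Require Import all_boot.
From mathcomp Require Import all_classical.
From mathcomp Require Import topology.

Set Implicit Arguments.
Unset Strict Implicit.
Unset Printing Implicit Defensive.

Local Open Scope classical_set_scope.
Local Open Scope group_scope.
Local Open Scope quotient_scope.

(* A topology on a fixed carrier G is an element of the structure class
   [Topological G], as in the library's [sup_topology]; this makes it possible
   to speak of several topologies on one group.  The class also contains a choice
   operator for G, so two topologies are compared through their open sets
   and never by Leibniz equality of classes. *)
Definition with_top (T : Type) (tau : Topological T) : topologicalType :=
  Topological.Pack tau.

Definition opens (T : Type) (tau : Topological T) : set (set T) :=
  @open (with_top tau).

Definition group_topology (G : groupType) (tau : Topological G) : Prop :=
  continuous (fun xy : with_top tau * with_top tau =>
    (xy.1 : G) * (xy.2 : G) : with_top tau) /\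
  continuous (fun x : with_top tau => (x : G)^-1 : with_top tau).

Definition hom (G H : groupType) (f : G -> H) : Prop :=
  {morph f : x y / x * y}.

Definition continuous_for (S T : Type) (tau : Topological S)
    (sigma : Topological T) (f : S -> T) : Prop :=
  continuous (f : with_top tau -> with_top sigma).

Definition open_map (S T : Type) (tau : Topological S)
    (sigma : Topological T) (f : S -> T) : Prop :=
  forall A : set S, opens tau A -> opens sigma (f @` A).

Definition normal_subgroup (G : groupType) (N : set G) : Prop :=
  [/\ N 1, forall x y, N x -> N y -> N (x / y)
    & forall x y, N x -> N (x ^ y)].

(* The containment of G in Gt as a topological subgroup is an injective
   homomorphism i for which tau consists of the preimages of the open sets of
   Gt. *)
Definition semitopological (G H : groupType) (tau : Topological G)
    (sigma : Topological H) (f : G -> H) : Prop :=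
  [/\ hom f, bijective f, continuous_for tau sigma f
    & exists (Gt : groupType) (taut : Topological Gt) (i : G -> Gt)
             (ft : Gt -> H),
      [/\ group_topology taut,
          [/\ hom i, injective i & normal_subgroup (range i)],
          opens tau = [set i @^-1` U | U in opens taut],
          [/\ hom ft, continuous_for taut sigma ft & open_map taut sigma ft]
        & forall x, ft (i x) = f x]].

Definition arnautov (G : groupType) : Prop :=
  forall sigma tau : Topological G,
    group_topology sigma -> group_topology tau ->
    opens sigma `<=` opens tau ->
    semitopological tau sigma (@id G) ->
    opens sigma = opens tau.

Definition centralizer (G : groupType) (F : set G) : set G :=
  [set c | forall x, F x -> commute c x].

Definition taimanov_topology (G : groupType) : Type := G.

Section TaimanovTopology.
Variable G : groupType.
Local Notation T := (taimanov_topology G).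

Definition taimanov_nbhs (x : T) : set_system T :=
  [set A | exists2 F : set G, finite_set F &
     forall c, centralizer F c -> A ((x : G) * c)].

HB.instance Definition _ := Choice.on T.
HB.instance Definition _ := hasNbhs.Build T taimanov_nbhs.

Let nbhs_filter (x : T) : ProperFilter (nbhs x).
Proof.
split.
  by move=> [F _ /(_ 1)]; apply => y _; rewrite /commute mul1g mulg1.
split.
- by exists set0.
- move=> A B [F finF FA] [F' finF' FB]; exists (F `|` F').
    by rewrite finite_setU.
  by move=> c cc; split; [apply: FA|apply: FB] => y Fy; apply: cc; [left|right].
- by move=> A B AB [F finF FA]; exists F => // c /FA /AB.
Qed.

Let nbhs_singleton (x : T) (A : set T) : nbhs x A -> A x.
Proof.
move=> [F _ /(_ 1)]; rewrite mulg1; apply => y _.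
by rewrite /commute mul1g mulg1.
Qed.

Lemma centralizerM (F : set G) (c d : G) :
  centralizer F c -> centralizer F d -> centralizer F (c * d).
Proof.
by move=> cF dF y Fy; rewrite /commute -mulgA (dF _ Fy) mulgA (cF _ Fy) -mulgA.
Qed.

Lemma centralizerV (F : set G) (c : G) : centralizer F c -> centralizer F c^-1.
Proof. by move=> cF y Fy; apply/commute_sym/commuteV/commute_sym/cF. Qed.

Let nbhs_nbhs (x : T) (A : set T) : nbhs x A -> nbhs x (nbhs^~ A).
Proof.
move=> [F finF FA]; exists F => // c cF; exists F => // d dF.
by rewrite -mulgA; apply: FA; exact: centralizerM.
Qed.

HB.instance Definition _ :=
  Nbhs_isNbhsTopological.Build T nbhs_filter nbhs_singleton nbhs_nbhs.

End TaimanovTopology.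

Definition taimanov_top (G : groupType) : Topological G :=
  Topological.class (taimanov_topology G).

Lemma taimanov_base1 (G : groupType) (A : set (taimanov_topology G)) :
  nbhs ((1 : G) : taimanov_topology G) A <-> exists2 F : set G, finite_set F & centralizer F `<=` A.
Proof.
split=> -[F finF FA]; exists F => // c /FA; first by rewrite mul1g.
by rewrite mul1g.
Qed.

Lemma centralizer_conj (G : groupType) (F : set G) (x c : G) :
  centralizer [set y ^ x | y in F] c -> centralizer F (c ^ x^-1).
Proof.
move=> cF y Fy.
have /(congr1 (fun z => z ^ x^-1)) : commute c (y ^ x) by apply: cF; exists y.
by rewrite conjMg conjgK conjMg conjgK.
Qed.

Lemma taimanov_group_topology (G : groupType) : group_topology (taimanov_top G).
Proof.
split.
- move=> [x y] A [F finF FA].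
  exists ([set x * c | c in centralizer [set z ^ y^-1 | z in F]],
          [set y * c | c in centralizer F]).
    split=> /=; last by exists F => // c cF; exists c.
    by exists [set z ^ y^-1 | z in F]; [exact: finite_image|move=> c cF; exists c].
  move=> [_ _] [/= [c cF <-] [d dF <-]].
  rewrite -[_ * _]/((x * c) * (y * d)).
  have -> : (x * c) * (y * d) = (x * y) * (c ^ y * d).
    by rewrite /conjg !mulgA mulgK.
  apply: FA; apply: centralizerM => //.
  by have := centralizer_conj cF; rewrite invgK.
- move=> x A [F finF FA]; exists [set z ^ x | z in F]; first exact: finite_image.
  move=> c cF.
  have xcV : (x * c)^-1 = x^-1 * (c ^ x^-1)^-1.
    by rewrite /conjg invgK !invgM invgK !mulgA mulVg mul1g.
  suff: A (x^-1 * (c ^ x^-1)^-1) by rewrite -xcV.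
  by apply: FA; apply: centralizerV; exact: centralizer_conj.
Qed.

Definition taimanov (G : groupType) : Prop :=
  opens (taimanov_top G) = setT.

Section Quotient.
Variables (G : groupType) (N : set G) (nN : normal_subgroup N).

Definition coset_rel : rel G := fun x y => `[< N (x^-1 * y) >].

Let N1 : N 1. Proof. by case: nN. Qed.
Let NV x : N x -> N x^-1.
Proof. by case: nN => _ NF _ Nx; rewrite -[_^-1]mul1g; exact: NF. Qed.
Let NM x y : N x -> N y -> N (x * y).
Proof.
by case: nN => _ NF _ Nx /NV Ny; rewrite -[y]invgK; exact: NF.
Qed.
Let NJ x y : N x -> N (x ^ y). Proof. by case: nN => _ _; apply. Qed.

Lemma coset_rel_refl : reflexive coset_rel.
Proof. by move=> x; apply/asboolP; rewrite mulVg. Qed.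

Lemma coset_rel_sym : symmetric coset_rel.
Proof.
move=> x y; apply/asboolP/asboolP => /NV; by rewrite invgM invgK.
Qed.

Lemma coset_rel_trans : transitive coset_rel.
Proof.
move=> y x z /asboolP xy /asboolP yz; apply/asboolP.
by have := NM xy yz; rewrite mulgA mulgK.
Qed.

Canonical coset_equiv :=
  EquivRel coset_rel coset_rel_refl coset_rel_sym coset_rel_trans.

Definition quotient_group := {eq_quot coset_equiv}.
Local Notation Q := quotient_group.

HB.instance Definition _ := Choice.on Q.
HB.instance Definition _ := EqQuotient.on Q.

Lemma quotient_piP (x y : G) : \pi_Q x = \pi_Q y <-> N (x^-1 * y).
Proof.
by split=> [/eqmodP/asboolP|Nxy] //; apply/eqmodP/asboolP.
Qed.

Definition quotient_one : Q := \pi_Q 1.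
Definition quotient_mul (a b : Q) : Q := \pi_Q (repr a * repr b).
Definition quotient_inv (a : Q) : Q := \pi_Q (repr a)^-1.

Let repr_pi (x : G) : N ((repr (\pi_Q x))^-1 * x).
Proof. by apply/quotient_piP; rewrite reprK. Qed.

Lemma quotient_piM (x y : G) :
  quotient_mul (\pi_Q x) (\pi_Q y) = \pi_Q (x * y).
Proof.
apply/quotient_piP; set r := repr _; set s := repr _.
have -> : (r * s)^-1 * (x * y) = (s^-1 * y) * (r^-1 * x) ^ y.
  by rewrite /conjg invgM !mulgA mulgK.
by apply: NM; [|apply: NJ]; exact: repr_pi.
Qed.

Lemma quotient_piV (x : G) : quotient_inv (\pi_Q x) = \pi_Q x^-1.
Proof.
apply/quotient_piP; rewrite invgK; set r := repr _.
have -> : r * x^-1 = ((r^-1 * x)^-1) ^ x^-1.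
  by rewrite /conjg invgM !invgK !mulgA mulgV mul1g.
by apply: NJ; apply: NV; exact: repr_pi.
Qed.

Let mulA : associative quotient_mul.
Proof.
elim/quotW=> x; elim/quotW=> y; elim/quotW=> z.
rewrite (quotient_piM y z) (quotient_piM x (y * z)) (quotient_piM x y).
by rewrite (quotient_piM (x * y) z) mulgA.
Qed.
Let mul1 : left_id quotient_one quotient_mul.
Proof. by elim/quotW=> x; rewrite quotient_piM mul1g. Qed.
Let mulr1 : right_id quotient_one quotient_mul.
Proof. by elim/quotW=> x; rewrite quotient_piM mulg1. Qed.
Let mulV : left_inverse quotient_one quotient_inv quotient_mul.
Proof. by elim/quotW=> x; rewrite quotient_piV quotient_piM mulVg. Qed.
Let mulrV : right_inverse quotient_one quotient_inv quotient_mul.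
Proof. by elim/quotW=> x; rewrite quotient_piV quotient_piM mulgV. Qed.

HB.instance Definition _ := isGroup.Build Q mulA mul1 mulr1 mulV mulrV.

Lemma quotient_pi_hom : hom (\pi_Q : G -> Q).
Proof. by move=> x y; rewrite -quotient_piM. Qed.

End Quotient.

Definition totally_taimanov (G : groupType) : Prop :=
  forall (N : set G) (nN : normal_subgroup N),
    taimanov (quotient_group nN).

(* Main.v *)
(* Let p : G -> Q be a surjective homomorphism (later the projection onto G/N).
   Pull back to G the discrete topology of Q (giving tau) and the Taimanov
   topology of Q (giving sigma).  The identity from tau to sigma is
   semitopological: embed G in G * G by x |-> (x, 1), extend the identity by the
   first projection, and give G * G the group topology whose neighborhoods of 1
   are the sets {(x, y) | p x = p y centralizes F}, F finite in Q.  They do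
   generate a group topology, because conjugation by (a, b) moves the diagonal
   element (c, c) of Q * Q to a diagonal element as soon as c commutes with
   (p a)(p b)^-1.  In an Arnautov group sigma = tau, hence ker p is sigma-open,
   which says that some finite F in Q has trivial centralizer. *)

Require Import Defs.
From HB Require Import structures.
From mathcomp Require Import all_boot.
From mathcomp Require Import all_classical.
From mathcomp Require Import topology.

Set Implicit Arguments.
Unset Strict Implicit.
Unset Printing Implicit Defensive.

Local Open Scope classical_set_scope.
Local Open Scope group_scope.

(** * Group topologies generated by a base of subgroups *)

Definition subgroup_base (K : groupType) (I : Type) (D : set I)
    (B : I -> set K) : Prop :=
  [/\ D !=set0,
      forall i, B i 1 /\ (forall x y, B i x -> B i y -> B i (x / y)),
      forall i j, D i -> D j -> exists2 k, D k & B k `<=` B i `&` B j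
    & forall i x, D i -> exists2 j, D j & forall c, B j c -> B i (c ^ x)].

(** An alias of [K] mentioning [hB], so that different bases give one group different topological
    instances. *)
Definition subgroup_topology (K : groupType) (I : Type) (D : set I)
  (B : I -> set K) (hB : subgroup_base D B) : Type := K.

Section SubgroupTopology.
Variables (K : groupType) (I : Type) (D : set I) (B : I -> set K).
Hypothesis hB : subgroup_base D B.
Local Notation T := (subgroup_topology hB).

Definition subgroup_nbhs (x : T) : set_system T :=
  [set A | exists2 i, D i & forall c, B i c -> A ((x : K) * c)].

HB.instance Definition _ := Choice.on T.
HB.instance Definition _ := hasNbhs.Build T subgroup_nbhs.

Let B1 i : B i 1. Proof. by case: hB => _ /(_ i)[]. Qed.
Let BV i x : B i x -> B i x^-1.
Proof.
by case: hB => _ /(_ i)[_ BF] _ _ Bx; rewrite -[_^-1]mul1g; exact: BF.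
Qed.
Let BM i x y : B i x -> B i y -> B i (x * y).
Proof.
by case: hB => _ /(_ i)[_ BF] _ _ Bx /BV By; rewrite -[y]invgK; exact: BF.
Qed.

Let nbhs_filter (x : T) : ProperFilter (nbhs x).
Proof.
have [[i0 Di0] _ BI _] := hB.
split; first by move=> [i _ /(_ 1 (B1 i))].
split.
- by exists i0.
- move=> A A' [i Di iA] [j Dj jA']; have [k Dk kij] := BI _ _ Di Dj.
  by exists k => // c /kij[ic jc]; split; [exact: iA|exact: jA'].
- by move=> A A' AA' [i Di iA]; exists i => // c /iA /AA'.
Qed.

Let nbhs_singleton (x : T) (A : set T) : nbhs x A -> A x.
Proof. by move=> [i _ /(_ 1 (B1 i))]; rewrite mulg1. Qed.

Let nbhs_nbhs (x : T) (A : set T) : nbhs x A -> nbhs x (nbhs^~ A).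
Proof.
move=> [i Di iA]; exists i => // c ic; exists i => // d id.
(* The same index serves at every point of the coset, because [B i] is closed under products. *)
by rewrite -mulgA; apply: iA; exact: BM.
Qed.

HB.instance Definition _ :=
  Nbhs_isNbhsTopological.Build T nbhs_filter nbhs_singleton nbhs_nbhs.

Definition subgroup_top : Topological K := Topological.class T.

Lemma opens_subgroup_top (A : set K) : opens subgroup_top A <->
  forall x, A x -> exists2 i, D i & forall c, B i c -> A (x * c).
Proof. by rewrite /opens openE. Qed.

Lemma nbhs_subgroup_top (x : K) (A : set K) :
  nbhs (x : with_top subgroup_top) A <->
  exists2 i, D i & forall c, B i c -> A (x * c).
Proof. by []. Qed.

(** Moving [c] past [y] turns it into [c ^ y], so both operations reduce to the conjugation
    condition of the base. *)
Lemma subgroup_top_group_topology : group_topology subgroup_top.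
Proof.
have [_ _ _ BJ] := hB; split.
- move=> [x y] A [i Di iA]; have [j Dj ji] := BJ i y Di.
  exists ([set x * c | c in B j], [set y * c | c in B i]).
    by split=> /=; [exists j|exists i] => // c cB; exists c.
  move=> [_ _] [/= [c jc <-] [d id <-]].
  rewrite -[_ * _]/((x * c) * (y * d)).
  have -> : (x * c) * (y * d) = (x * y) * (c ^ y * d).
    by rewrite /conjg !mulgA mulgK.
  by apply: iA; apply: BM => //; exact: ji.
- move=> x A [i Di iA]; have [j Dj ji] := BJ i x^-1 Di.
  exists j => // c /ji/BV ic.
  have xcV : (x * c)^-1 = x^-1 * (c ^ x^-1)^-1.
    by rewrite /conjg invgK !invgM invgK !mulgA mulVg mul1g.
  suff: A (x^-1 * (c ^ x^-1)^-1) by rewrite -xcV.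
  exact: iA.
Qed.

End SubgroupTopology.

Lemma centralizer1 (G : groupType) (F : set G) : centralizer F 1.
Proof. by move=> y _; rewrite /commute mul1g mulg1. Qed.

Lemma centralizerS (G : groupType) (F F' : set G) :
  F `<=` F' -> centralizer F' `<=` centralizer F.
Proof. by move=> FF' c cF' x /FF'; exact: cF'. Qed.

Lemma mulg_pair (G H : groupType) (x y : G) (x' y' : H) :
  (x, x') * (y, y') = (x * y, x' * y').
Proof. by []. Qed.

Lemma taimanovP (G : groupType) :
  (exists2 F : set G, finite_set F & centralizer F `<=` [set 1]) -> taimanov G.
Proof.
move=> [F finF F1]; apply/seteqP; split => // A _.
rewrite /opens openE => x Ax; exists F => // c /F1 ->.
by rewrite mulg1.
Qed.

(** * The three topologies attached to a homomorphism *)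

Section Hom.
Variables (G Q : groupType) (p : G -> Q) (pM : hom p).

Let p1 : p 1 = 1.
Proof. by apply: (@mulgI _ (p 1)); rewrite -pM !mulg1. Qed.
Let pV x : p x^-1 = (p x)^-1.
Proof. by apply: (@mulgI _ (p x)); rewrite -pM !mulgV p1. Qed.
Let pJ x y : p (x ^ y) = p x ^ p y.
Proof. by rewrite /conjg !pM pV. Qed.

(** The kernel alone is a base for the pullback of the discrete topology, hence the one-point index
    type. *)
Definition ker_base (_ : unit) : set G := [set x | p x = 1].

Definition centralizer_base (F : set Q) : set G :=
  [set x | centralizer F (p x)].

Definition diagonal_base (F : set Q) : set (G * G) :=
  [set xy | p xy.1 = p xy.2 /\ centralizer F (p xy.2)].

Lemma ker_baseP : subgroup_base setT ker_base.
Proof.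
rewrite /ker_base; split => /=.
- by exists tt.
- by move=> _; split=> // x y /= px py; rewrite pM pV px py mulgV.
- by move=> _ _ _ _; exists tt.
- by move=> _ x _; exists tt => // c /= pc; rewrite pJ pc conj1g.
Qed.

Lemma diagonal_baseP : subgroup_base finite_set diagonal_base.
Proof.
rewrite /diagonal_base; split => /=.
- by exists set0; exact: finite_set0.
- move=> F; split=> /=.
    by split=> //; rewrite p1; exact: centralizer1.
  move=> [x y] [x' y'] [/= pxy cy] [/= pxy' cy'].
  rewrite !pM !pV pxy pxy'; split=> //.
  by apply: centralizerM => //; exact: centralizerV.
- move=> F F' finF finF'; exists (F `|` F'); first by rewrite finite_setU.
  move=> [x y] /= [-> cy]; split; split=> //; apply: centralizerS cy.
    exact: subsetUl.
  exact: subsetUr.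
- move=> F [a b] finF.
  (* The added point makes conjugation by [p a] and by [p b] agree on [p y]; the conjugates of [F]
     put [p y ^ p b] in the centralizer of [F]. *)
  exists ((p a * (p b)^-1) |` [set y ^ (p b)^-1 | y in F]).
    rewrite finite_setU; split; first exact: finite_set1.
    exact: finite_image.
  move=> [x y] [/= pxy cy].
  have cab : commute (p y) (p a * (p b)^-1) by apply: cy; left.
  rewrite !pJ pxy; split.
    apply: (can_inj (conjgK (p b)^-1)); rewrite -!conjgM mulgV conjg1.
    by rewrite /conjg cab mulgA mulVg mul1g.
  rewrite -[p b]invgK; apply: centralizer_conj.
  by apply: centralizerS cy => z; right.
Qed.

(** This is the diagonal base restricted along [x |-> (x, x)], so its conditions are inherited. *)
Lemma centralizer_baseP : subgroup_base finite_set centralizer_base.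
Proof.
have [_ diag1 diagI diagJ] := diagonal_baseP; split.
- by exists set0; exact: finite_set0.
- move=> F; have [[_ c1] cF] := diag1 F; split=> // x y cx cy.
  by have [] := cF (x, x) (y, y) (conj erefl cx) (conj erefl cy).
- move=> F F' finF finF'; have [F'' finF'' sub] := diagI F F' finF finF'.
  by exists F'' => // x cx; have [[_ ?] [_ ?]] := sub (x, x) (conj erefl cx).
- move=> F a finF; have [F' finF' sub] := diagJ F (a, a) finF.
  by exists F' => // c cc; have [] := sub (c, c) (conj erefl cc).
Qed.

Let tau := subgroup_top ker_baseP.
Let sigma := subgroup_top centralizer_baseP.
Let tautilde := subgroup_top diagonal_baseP.

Lemma ker_top_finer : opens sigma `<=` opens tau.
Proof.
move=> A /opens_subgroup_top Asigma; apply/opens_subgroup_top => x /Asigma.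
move=> [F finF FA]; exists tt => // c pc; apply: FA.
by rewrite /centralizer_base /= pc; exact: centralizer1.
Qed.

Lemma opens_ker_top :
  opens tau = [set (fun x : G => (x, 1 : G)) @^-1` U | U in opens tautilde].
Proof.
apply/seteqP; split=> [A /opens_subgroup_top Atau|_ [U /opens_subgroup_top Uop <-]].
  (* The map [(x, y) |-> x / y] retracts [G * G] onto [G]. If [p c = p d], then [c / d] and its
     conjugates lie in the kernel, so this preimage is open already with [F] empty. *)
  exists [set xy | A (xy.1 / xy.2)]; last first.
    by apply/seteqP; split=> x /=; rewrite divg1.
  apply/opens_subgroup_top => -[x y] /= /Atau[t _ Axy].
  exists set0; first exact: finite_set0.
  move=> [c d] [/= pcd _].
  have -> : x * c / (y * d) = x / y * (c / d) ^ y^-1.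
    by rewrite /conjg invgK invgM !mulgA mulgVK.
  by apply: Axy; rewrite /ker_base /= pJ pM pV pcd mulgV conj1g.
(* For [c] in the kernel, [(c, 1)] lies in every [diagonal_base F]. *)
apply/opens_subgroup_top => x /= /Uop[F finF FU]; exists tt => // c pc.
have -> : (x * c, 1) = (x, 1) * (c, 1) :> G * G.
  by rewrite mulg_pair mulg1.
apply: FU; split=> /=; rewrite ?p1 //; exact: centralizer1.
Qed.

Lemma semitopological_id : semitopological tau sigma (@id G).
Proof.
split=> //; first by exists id.
  move=> x A /nbhs_subgroup_top[F finF FA]; apply/nbhs_subgroup_top.
  exists tt => // c pc; apply: FA.
  by rewrite /centralizer_base /= pc; exact: centralizer1.
exists (G * G)%type, tautilde, (fun x => (x, 1)), fst; split=> //.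
- exact: subgroup_top_group_topology.
- split=> [x y|x y []//|].
    by rewrite mulg_pair mulg1.
  split; first by exists 1.
    move=> _ _ [x _ <-] [y _ <-]; exists (x / y) => //.
    by rewrite mulg_pair divg1.
  move=> _ [a b] [x _ <-]; exists (x ^ a) => //.
  by rewrite /conjg !mulg_pair mul1g mulVg.
- exact: opens_ker_top.
- split=> //.
    move=> [x y] A /nbhs_subgroup_top[F finF FA].
    apply/nbhs_subgroup_top; exists F => // -[c d] [/= pcd cd].
    by apply: FA; rewrite /centralizer_base /= pcd.
  move=> U /opens_subgroup_top Uop; apply/opens_subgroup_top.
  move=> _ [[x y] Uxy <-]; have [F finF FU] := Uop _ Uxy.
  (* Openness of [fst]: each [c] in [centralizer_base F] lifts to [(c, c)] in [diagonal_base F]. *)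
  exists F => // c cF; exists ((x, y) * (c, c)) => //.
  exact: FU.
Qed.

Lemma arnautov_taimanov_image :
  (forall y, exists x, p x = y) -> arnautov G -> taimanov Q.
Proof.
move=> p_surj /(_ sigma tau (subgroup_top_group_topology _)
  (subgroup_top_group_topology _) ker_top_finer semitopological_id) sigmatau.
have : opens sigma [set x | p x = 1].
  rewrite sigmatau; apply/opens_subgroup_top => x /= px; exists tt => // c pc.
  by rewrite pM px pc mulg1.
(* Openness at 1 only controls centralizing elements of the form [p x]; surjectivity extends this to
   all of [Q]. *)
move=> /opens_subgroup_top /(_ 1 p1)[F finF F1]; apply: taimanovP.
exists F => // y; have [x <-] := p_surj y => cx.
by have := F1 x cx; rewrite /= mul1g.
Qed.

End Hom.

Theorem theorem5p16 (G : groupType) : arnautov G -> totally_taimanov G.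
Proof.
move=> arnG N nN.
apply: (arnautov_taimanov_image (@quotient_pi_hom G N nN)) => // y.
by exists (repr y); rewrite reprK.
Qed.
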